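(* Let $X$ be a locally compact metric space, $f\colon X\to X$ a continuous map, and $S\subset X$ an isolated invariant set for $f$. The (unreduced) mapping torus index of $(S,f)$ is independent of the choice of an index pair: if $(N_\alpha,L_\alpha)$ and $(N_\beta,L_\beta)$ are index pairs for $(S,f)$ with index maps $f_{(N_\alpha,L_\alpha)}$ and $f_{(N_\beta,L_\beta)}$, then the mapping tori $\operatorname{T}(f_{(N_\alpha,L_\alpha)})$ and $\operatorname{T}(f_{(N_\beta,L_\beta)})$ are homotopy equivalent.
   Context: For $M\subset X$, $\operatorname{Inv}(M,f)$ is the set of $x\in M$ for which there is a sequence $\gamma\colon\mathbb{Z}\to M$ with $\gamma(0)=x$ and $\gamma(n+1)=f(\gamma(n))$ for all $n\in\mathbb{Z}$. A set $S\subset X$ is isolated invariant if it is compact and has a neighborhood $M$ with $\operatorname{Inv}(M,f)=S$. Quotients: for $\varnothing\ne Y\subset Z$, $Z/Y$ is the pointed quotient space with base point $[Y]$; $Z/\varnothing:=Z\sqcup\{*\}$ with base point $*$ (denoted $[\varnothing]$). Index pairs: a pair $(N,L)$ of compact sets $L\subset N\subset X$ is an index pair for $(S,f)$ if $\operatorname{Inv}(\operatorname{cl}(N\setminus L),f)=S\subset\operatorname{int}(N\setminus L)$ and the map $f_{(N,L)}\colon N/L\to N/L$ given by $f_{(N,L)}([x])=[f(x)]$ if $x,f(x)\in N\setminus L$ and $f_{(N,L)}([x])=[L]$ otherwise is continuous; then $f_{(N,L)}$ is called the index map. Mapping torus: for a continuous map $\kappa\colon P\to P$, $\operatorname{T}(\kappa):=(P\times[0,1])/\big((x,1)\sim(\kappa(x),0)\big)$.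 The (unreduced) mapping torus index of $(S,f)$ is the (unpointed) homotopy type of $\operatorname{T}(f_{(N,L)})$, where $(N,L)$ is an index pair for $(S,f)$. *)

(* Defs.v *)
From HB Require Import structures.
From mathcomp Require Import all_boot all_order all_algebra generic_quotient.
From mathcomp Require Import all_classical all_reals all_analysis.
From Stdlib Require Import Relation_Operators.

Set Implicit Arguments.
Unset Strict Implicit.
Unset Printing Implicit Defensive.

Import Order.TTheory GRing.Theory Num.Theory.
Import numFieldNormedType.Exports.

Local Open Scope classical_set_scope.
Local Open Scope ring_scope.
Local Open Scope quotient_scope.

Definition invariant_part {X : Type} (M : set X) (f : X -> X) : set X :=
  [set x | M x /\ exists gamma : int -> X,
    [/\ forall n, M (gamma n), gamma 0 = x &
        forall n, gamma (n + 1) = f (gamma n)]].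

(* `S `<=` M°` says that M is a neighborhood of S. *)
Definition isolated_invariant {X : topologicalType} (f : X -> X) (S : set X) :=
  compact S /\ exists M : set X, S `<=` M° /\ invariant_part M f = S.

(* The disjoint union of Z and a point. The library's one-point
   compactification has the same carrier, but in general a coarser topology. *)
Definition adjoin_point (Z : Type) : Type := option Z.

Section adjoin_point_topology.
Context {Z : topologicalType}.
Local Notation Zp := (adjoin_point Z).

HB.instance Definition _ := Choice.on Zp.
HB.instance Definition _ := Pointed.on Zp.

Definition adjoin_point_open : set (set Zp) :=
  [set U | open ((Some : Z -> Zp) @^-1` U)].

Local Lemma adjoin_point_openT : adjoin_point_open setT.
Proof. by rewrite /adjoin_point_open /= preimage_setT; exact: openT. Qed.

Local Lemma adjoin_point_openI (A B : set Zp) :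
  adjoin_point_open A -> adjoin_point_open B -> adjoin_point_open (A `&` B).
Proof. by move=> oA oB; exact: openI. Qed.

Local Lemma adjoin_point_open_bigU (I : Type) (g : I -> set Zp) :
  (forall i, adjoin_point_open (g i)) -> adjoin_point_open (\bigcup_i g i).
Proof. by move=> og; apply: bigcup_open => i _; exact: og. Qed.

HB.instance Definition _ := isOpenTopological.Build Zp
  adjoin_point_openT adjoin_point_openI adjoin_point_open_bigU.

End adjoin_point_topology.

(* Z/Y is encoded, for every Y, as the quotient of Z + {*} in which
   Y + {*} is collapsed to the base point. If Y is empty nothing is
   identified, so this is Z + {*}; if Y is nonempty this is the usual quotient
   of Z by Y, based at [Y]. By `pquot_openP`, `pquot_classP` and
   `pquotN0_surj` (Y nonempty) or `pquot_surj`, `pquot0_inj` and `pquot0_base`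
   (Y empty), the points and the topology are the expected ones. *)
Section pointed_quotient.
Context {Z : topologicalType} (Y : set Z).

Definition collapsed (a : adjoin_point Z) : Prop :=
  if a is Some x then Y x else True.

Let collapse_rel' (a b : adjoin_point Z) : bool :=
  `[< a = b \/ (collapsed a /\ collapsed b) >].

Local Lemma collapse_rel_refl : reflexive collapse_rel'.
Proof. by move=> a; apply/asboolP; left. Qed.

Local Lemma collapse_rel_sym : symmetric collapse_rel'.
Proof.
by move=> a b; apply/asboolP/asboolP => -[->|[? ?]]; by [left | right].
Qed.

Local Lemma collapse_rel_trans : transitive collapse_rel'.
Proof.
move=> b a c /asboolP[->//|[ca cb]] /asboolP[<-|[_ cc]]; apply/asboolP.
  by right.
by right.
Qed.

Definition collapse_rel :=
  EquivRel _ collapse_rel_refl collapse_rel_sym collapse_rel_trans.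

Definition pquot := {eq_quot collapse_rel}.

HB.instance Definition _ := Topological.copy pquot (quotient_topology pquot).
HB.instance Definition _ := Quotient.on pquot.

Definition pquot_base : pquot := \pi_pquot None.
Definition pquot_class (x : Z) : pquot := \pi_pquot (Some x).

HB.instance Definition _ := isPointed.Build pquot pquot_base.

Lemma pquot_openP (U : set pquot) : open U <-> open (pquot_class @^-1` U).
Proof. by []. Qed.

Lemma pquot_classP (x y : Z) :
  pquot_class x = pquot_class y <-> x = y \/ (Y x /\ Y y).
Proof.
split=> [/eqmodP/asboolP[[->]|[]]|[->//|[Yx Yy]]]; [by left|by right|].
by apply/eqmodP/asboolP; right.
Qed.

Lemma pquot_class_baseP (x : Z) : pquot_class x = pquot_base <-> Y x.
Proof.
split=> [/eqmodP/asboolP[//|[]]//|Yx].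
by apply/eqmodP/asboolP; right.
Qed.

Lemma pquot_surj (q : pquot) : q = pquot_base \/ exists x, q = pquot_class x.
Proof.
rewrite -[q]reprK; case: (repr q) => [x|]; last by left.
by right; exists x.
Qed.

Lemma pquotN0_surj (q : pquot) : Y !=set0 -> exists x, q = pquot_class x.
Proof.
move=> [y Yy]; case: (pquot_surj q) => [->|//].
by exists y; apply/esym/pquot_class_baseP.
Qed.

Lemma pquot0_inj : Y = set0 -> injective pquot_class.
Proof. by move=> Y0 x y /pquot_classP[//|]; rewrite Y0 => -[]. Qed.

Lemma pquot0_base (x : Z) : Y = set0 -> pquot_class x <> pquot_base.
Proof. by move=> Y0 /pquot_class_baseP; rewrite Y0. Qed.

End pointed_quotient.

(* N/L for L `<=` N subsets of X: the quotient is that of the subspace N. *)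
Definition index_space {X : topologicalType} (N L : set X) :=
  @pquot N (set_val @^-1` L).

Section index_pair_map.
Context {X : topologicalType} (f : X -> X) (N L : set X).
Local Notation Q := (index_space N L).

(* `insub (f (\val x))` is `Some` of `f x` seen as a point of N, as f x lies in
   N in that branch. The result does not depend on the representative chosen by
   `repr`, as stated by the lemmas `index_pair_map_*` below. *)
Definition index_pair_map (q : Q) : Q :=
  if repr q is Some x then
    if `[< (N `\` L) (\val x) /\ (N `\` L) (f (\val x)) >]
    then \pi_Q (insub (f (\val x))) else pquot_base _
  else pquot_base _.

Lemma index_pair_map_in (x y : N) :
  (N `\` L) (\val x) -> (N `\` L) (\val y) -> f (\val x) = \val y ->
  index_pair_map (pquot_class _ x) = pquot_class _ y.
Proof.
move=> Nx Ny fxy; rewrite /index_pair_map.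
have : pquot_class (set_val @^-1` L) x = \pi_Q (repr (pquot_class _ x : Q)).
  by rewrite reprK.
case: (repr _) => [z|].
  move=> /pquot_classP[<-|[Lx]]; last by case: Nx.
  by rewrite asboolT; [rewrite fxy valK | rewrite fxy].
by move/pquot_class_baseP => Lx; case: Nx.
Qed.

Lemma index_pair_map_out (x : N) :
  ~ ((N `\` L) (\val x) /\ (N `\` L) (f (\val x))) ->
  index_pair_map (pquot_class _ x) = pquot_base _.
Proof.
move=> nx; rewrite /index_pair_map.
have : pquot_class (set_val @^-1` L) x = \pi_Q (repr (pquot_class _ x : Q)).
  by rewrite reprK.
case: (repr _) => [z|//] /pquot_classP[<-|[_ Lz]]; first by rewrite asboolF.
by rewrite asboolF// => -[[]].
Qed.

Lemma index_pair_map_base : index_pair_map (pquot_base _) = pquot_base _.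
Proof.
rewrite /index_pair_map.
have : pquot_base (set_val @^-1` L) = \pi_Q (repr (pquot_base _ : Q)).
  by rewrite reprK.
case: (repr _) => [z|//] /esym/pquot_class_baseP Lz.
by rewrite asboolF// => -[[]].
Qed.

End index_pair_map.

Arguments index_pair_map {X} f N L q.

Definition index_pair {X : topologicalType} (f : X -> X) (S N L : set X) :=
  [/\ L `<=` N, compact N /\ compact L,
      invariant_part (closure (N `\` L)) f = S, S `<=` (N `\` L)° &
      continuous (index_pair_map f N L)].

Definition unit_interval (R : realType) : topologicalType :=
  set_type `[0%R, 1%R : R]%classic.

Section unit_interval_ends.
Variable R : realType.

Local Lemma unit_interval0 : (0 : R) \in `[0%R, 1%R : R]%classic.
Proof. by rewrite inE /= in_itv /= lexx ler01. Qed.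

Local Lemma unit_interval1 : (1 : R) \in `[0%R, 1%R : R]%classic.
Proof. by rewrite inE /= in_itv /= lexx ler01. Qed.

Definition I0 : unit_interval R := SigSub unit_interval0.
Definition I1 : unit_interval R := SigSub unit_interval1.
End unit_interval_ends.

Section mapping_torus.
Variables (R : realType) (P : topologicalType) (kappa : P -> P).
Local Notation cylinder := (P * unit_interval R)%type.

Inductive torus_glue : cylinder -> cylinder -> Prop :=
  TorusGlue x : torus_glue (x, I1 R) (kappa x, I0 R).

Let torus_rel' (a b : cylinder) : bool :=
  `[< clos_refl_sym_trans _ torus_glue a b >].

Local Lemma torus_rel_refl : reflexive torus_rel'.
Proof. by move=> a; apply/asboolP; exact: rst_refl. Qed.

Local Lemma torus_rel_sym : symmetric torus_rel'.
Proof. by move=> a b; apply/asboolP/asboolP; exact: rst_sym. Qed.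

Local Lemma torus_rel_trans : transitive torus_rel'.
Proof.
by move=> b a c /asboolP ab /asboolP bc; apply/asboolP/(rst_trans _ _ _ b).
Qed.

Definition torus_rel :=
  EquivRel _ torus_rel_refl torus_rel_sym torus_rel_trans.

Definition mapping_torus := {eq_quot torus_rel}.

HB.instance Definition _ :=
  Topological.copy mapping_torus (quotient_topology mapping_torus).
HB.instance Definition _ := Quotient.on mapping_torus.

End mapping_torus.

Definition homotopic (R : realType) {A B : topologicalType} (g h : A -> B) :=
  exists H : (A * unit_interval R)%type -> B,
    [/\ continuous H, forall a, H (a, I0 R) = g a &
        forall a, H (a, I1 R) = h a].

Definition homotopy_equivalent (R : realType) (A B : topologicalType) :=
  exists (g : A -> B) (h : B -> A),
    [/\ continuous g, continuous h,
        homotopic R (h \o g) idfun & homotopic R (g \o h) idfun].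

(* Main.v *)
(** Write P for N \ L and g for the index map, which follows the f-orbit of a
point as long as this orbit stays in P and then drops to the base point. Since
Inv(cl P_a) = S lies in the interior of P_b, compactness gives an m such that
f^m x is in P_b as soon as x, ..., f^(2m) x are in P_a, and symmetrically. Then
x |-> f^(3m) x, restricted to the x with x, ..., f^(2m) x in P_a and
f^m x, ..., f^(3m) x in P_b, extends continuously by the base point to a map
r from N_a/L_a to N_b/L_b. With the map s in the other direction, r and s
intertwine the index maps, and s r and r s are their 6m-th iterates: the index
maps are shift equivalent. The self-map of the mapping torus of g induced by the
k-th iterate of g is the time-k map of the suspension semiflow, hence homotopic
to the identity, so r and s induce homotopy equivalences. *)

Require Import Defs.
From mathcomp Require Import all_boot all_order all_algebra generic_quotient.
From mathcomp Require Import all_classical all_reals all_analysis.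
From mathcomp Require Import lra zify.
From Stdlib Require Import Relation_Operators.

Set Implicit Arguments.
Unset Strict Implicit.
Unset Printing Implicit Defensive.

Import Order.TTheory GRing.Theory Num.Theory.
Import numFieldNormedType.Exports.

Local Open Scope classical_set_scope.
Local Open Scope ring_scope.
Local Open Scope quotient_scope.

(** * Continuity on products and quotients *)

Lemma pair_continuous (T U V : topologicalType) (f : T -> U) (g : T -> V) :
  continuous f -> continuous g -> continuous (fun x => (f x, g x)).
Proof.
move=> cf cg x.
exact: (@cvg_pair _ _ _ (nbhs x) (nbhs (f x)) (nbhs (g x)) _ _ _ f g
  (cf x) (cg x)).
Qed.

Lemma fst_continuous (U V : topologicalType) : continuous (@fst U V).
Proof. by move=> x; exact: cvg_fst. Qed.

Lemma snd_continuous (U V : topologicalType) : continuous (@snd U V).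
Proof. by move=> x; exact: cvg_snd. Qed.

Lemma continuousT_comp (T U V : topologicalType) (g : U -> V) (f : T -> U) :
  continuous g -> continuous f -> continuous (g \o f).
Proof. by move=> cg cf x; apply: continuous_comp; [exact: cf|exact: cg]. Qed.

(* For V locally compact, quotient maps times V are quotient maps; here this is
   read off the currying adjunction for the compact-open topology. *)
Lemma quotient_prod_continuous (T : topologicalType) (Q0 : quotType T)
    (V W : topologicalType) (H : quotient_topology Q0 * V -> W) :
  locally_compact [set: V] -> @regular_space V ->
  continuous (fun p : T * V => H (\pi_(quotient_topology Q0) p.1, p.2)) ->
  continuous H.
Proof.
move=> lcV regV /continuous_curry[cH1 cH2].
have -> : H = uncurry (curry H) by apply/funext => -[].
apply: continuous_uncurry_regular => //.
  exact: (quotient_continuous (Z := {compact-open, V -> W}) _).2 cH1.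
by move=> q; rewrite -[q]reprK; exact: cH2.
Qed.

(** * The unit interval *)

Section unit_interval_lemmas.
Variable R : realType.

Lemma clamp_subproof (x : R) :
  Num.max 0 (Num.min x 1) \in `[0%R, 1%R : R]%classic.
Proof.
by rewrite inE /= in_itv /= le_max lexx/= ge_max ler01/= ge_min lexx orbT.
Qed.

(** A retraction of the line onto [0, 1]: heights can then be handled as real numbers, free of
    membership proofs. *)
Definition clamp (x : R) : unit_interval R := SigSub (clamp_subproof x).

Lemma clamp_continuous : continuous clamp.
Proof.
have cmm : continuous ((fun=> 0) \max (id \min (fun=> 1)) : R -> R^o).
  move=> x; apply: continuous_max; first exact: cst_continuous.
  by apply: continuous_min; [exact: cvg_id|exact: cst_continuous].
exact: (@continuous_comp_initial _ _ _
  (set_val : `[0%R, 1%R : R]%classic -> R)).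
Qed.

Lemma val_clamp (x : R) : 0 <= x <= 1 -> \val (clamp x) = x.
Proof. by move=> /andP[x0 x1]; rewrite /= min_l// max_r. Qed.

Lemma clampK (t : unit_interval R) : clamp (\val t) = t.
Proof.
apply: val_inj; rewrite val_clamp//.
by have := set_valP t; rewrite /= in_itv.
Qed.

Lemma clamp0 : clamp 0 = I0 R.
Proof. by apply: val_inj; rewrite val_clamp//= lexx ler01. Qed.

Lemma clamp1 : clamp 1 = I1 R.
Proof. by apply: val_inj; rewrite val_clamp//= lexx ler01. Qed.

Lemma unit_interval_compact : compact [set: unit_interval R].
Proof.
have -> : [set: unit_interval R] = clamp @` `[0, 1]%classic.
  apply/seteqP; split => // t _; exists (\val t); first exact: set_valP.
  exact: clampK.
apply: continuous_compact; last exact: segment_compact.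
by apply: continuous_subspaceT; exact: clamp_continuous.
Qed.

Lemma unit_interval_regular : @regular_space (unit_interval R).
Proof. exact: (@uniform_regular (set_type `[0%R, 1%R : R]%classic)). Qed.

Lemma unit_interval_locally_compact : locally_compact [set: unit_interval R].
Proof.
move=> t _; exists setT; first exact: filterT.
by split; [exact: unit_interval_compact|exact: closedT].
Qed.

End unit_interval_lemmas.

(** * The suspension semiflow on a mapping torus *)

Section mapping_torus_flow.
Variables (R : realType) (P : topologicalType) (kappa : P -> P).
Local Notation T := (mapping_torus R kappa).

Definition torus_point (x : P) (u : R) : T := \pi_T (x, clamp u).

Lemma torus_point_glue x : torus_point x 1 = torus_point (kappa x) 0.
Proof.
rewrite /torus_point clamp0 clamp1; apply/eqmodP/asboolP/rst_step.
exact: TorusGlue.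
Qed.

Lemma torus_lift_pi (B : Type) (u : P * unit_interval R -> B) a :
  (forall x, u (x, I1 R) = u (kappa x, I0 R)) -> u (repr (\pi_T a)) = u a.
Proof.
move=> ug; have /eqmodP/asboolP : repr (\pi_T a) = a %[mod T] by rewrite reprK.
move: (repr _) => b; elim=> [_ _ [x]|//|c d _ ->|c d e _ -> _ ->] //.
Qed.

Lemma torus_point_continuous :
  continuous (fun p : P * R => torus_point p.1 p.2).
Proof.
apply: (@continuousT_comp _ _ _ \pi_T (fun p : P * R => (p.1, clamp p.2))).
  exact: (@pi_continuous _ (mapping_torus R kappa)).
apply: pair_continuous; first exact: fst_continuous.
exact: continuousT_comp (@clamp_continuous R) (@snd_continuous _ _).
Qed.

(* The suspension semiflow started at the point of height 0 over x; it is
   correct for times u in [0, k + 1] only. *)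
Fixpoint torus_flow (k : nat) (x : P) (u : R) : T :=
  if k is k'.+1 then
    if u <= 1 then torus_point x u else torus_flow k' (kappa x) (u - 1)
  else torus_point x u.

Lemma torus_flow_le1 k x u : u <= 1 -> torus_flow k x u = torus_point x u.
Proof. by case: k => //= k ->. Qed.

(** For u > 0 this is the recursive branch; at u = 0 the left side stops at height 1 and the gluing
    gives the equality. *)
Lemma torus_flow_step k x u : 0 <= u ->
  torus_flow k.+1 x (1 + u) = torus_flow k (kappa x) u.
Proof.
rewrite le_eqVlt => /predU1P[<-|u0].
  by rewrite addr0 !torus_flow_le1// torus_point_glue.
by rewrite /= gerDl leNgt u0 /= addrC addKr.
Qed.

(** The additional level of recursion is entered only at times beyond k + 1. *)
Lemma torus_flowS k x u : u <= k%:R + 1 ->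
  torus_flow k.+1 x u = torus_flow k x u.
Proof.
elim: k x u => [|k IH] x u uk; first by rewrite torus_flow_le1//; lra.
rewrite [LHS]/= [RHS]/=; case: ifP => // _.
by apply: IH; rewrite -natr1 in uk; lra.
Qed.

Lemma torus_flow_iter k x t : 0 <= t <= 1 ->
  torus_flow k x (k%:R + t) = torus_point (iter k kappa x) t.
Proof.
move=> /andP[t0 t1]; elim: k x => [|k IH] x; first by rewrite add0r.
by rewrite -nat1r -addrA torus_flow_step ?addr_ge0// IH -iterSr.
Qed.

(** Pasting along the closed sets u <= 1 and u >= 1; by [torus_flow_step] the recursive formula is
    valid at u = 1 too. *)
Lemma torus_flow_continuous k : continuous kappa ->
  continuous (fun p : P * R => torus_flow k p.1 p.2).
Proof.
move=> ck; elim: k => [|k IH]; first exact: torus_point_continuous.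
pose A := [set p : P * R | p.2 <= 1]; pose B := [set p : P * R | 1 <= p.2].
have cA : closed A.
  apply: (preimage_closed _ (@closed_le R 1)) => ? _; exact: snd_continuous.
have cB : closed B.
  apply: (preimage_closed _ (@closed_ge R 1)) => ? _; exact: snd_continuous.
apply/continuous_subspace_setT.
have -> : setT = A `|` B.
  by apply/seteqP; split=> // p _; apply/orP; exact: le_total.
apply: withinU_continuous => //.
  apply: (@subspace_eq_continuous _ _ _ (fun p => torus_point p.1 p.2)).
    by move=> p; rewrite inE => pA; exact/esym/torus_flow_le1.
  exact/continuous_subspaceT/torus_point_continuous.
pose h (p : P * R) := torus_flow k (kappa p.1) (p.2 - 1).
apply: (@subspace_eq_continuous _ B T h (fun p => torus_flow k.+1 p.1 p.2)).
  move=> p; rewrite inE => pB; have := @torus_flow_step k p.1 (p.2 - 1).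
  by rewrite subr_ge0 addrC subrK => /(_ pB) ->.
apply/continuous_subspaceT.
apply: (@continuousT_comp _ _ _ (fun p => torus_flow k p.1 p.2)
  (fun p : P * R => (kappa p.1, p.2 - 1))) => //.
apply: pair_continuous; first exact: continuousT_comp ck (@fst_continuous _ _).
by move=> p; apply: cvgB; [exact: cvg_snd|exact: cvg_cst].
Qed.

Lemma torus_flow_homotopic k (h : T -> T) : continuous kappa ->
  (forall x t, h (torus_point x t) = torus_point (iter k kappa x) t) ->
  homotopic R h idfun.
Proof.
move=> ck hE.
(* From height t, flow for the time k(1 - s): this is the time-k map at s = 0 and the identity at s
   = 1. As t <= 1, the argument stays in [0, k + 1], where [torus_flow k] is correct. *)
pose G (p : P * unit_interval R) (s : unit_interval R) : T :=
  torus_flow k p.1 (\val p.2 + k%:R * (1 - \val s)).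
have I01 (s : unit_interval R) : 0 <= \val s <= 1.
  by have := set_valP s; rewrite /= in_itv.
have GE x t s : G (repr (torus_point x t)) s = G (x, clamp t) s.
  apply: (@torus_lift_pi _ (G^~ s)) => {}x; rewrite /G /=.
  have /andP[s0 s1] := I01 s.
  (* One more level of recursion is made available, to pass from (x, 1) to the glued point (kappa x,
     0). *)
  rewrite -torus_flowS.
    by rewrite torus_flow_step ?add0r// mulr_ge0// subr_ge0.
  by rewrite addrC lerD2r ler_piMr// gerBl.
have reprE z : exists x t, z = torus_point x (\val (t : unit_interval R)).
  by rewrite -[z]reprK; case: (repr z) => x t; exists x, t;
    rewrite /torus_point clampK.
exists (fun p => G (repr p.1) p.2); split.
(* Continuity can be tested before gluing, as the homotopy parameter ranges over a compact
   interval. *)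
- apply: quotient_prod_continuous.
  + exact: unit_interval_locally_compact.
  + exact: unit_interval_regular.
  pose F (p : P * unit_interval R * unit_interval R) :=
    (p.1.1, \val p.1.2 + k%:R * (1 - \val p.2)).
  have -> : (fun p : P * unit_interval R * unit_interval R =>
      G (repr (\pi_T p.1)) p.2) = (fun q => torus_flow k q.1 q.2) \o F.
    apply/funext => -[[x t] s] /=.
    by have := GE x (\val t) s; rewrite /torus_point clampK => ->.
  apply: continuousT_comp; first exact: torus_flow_continuous.
  have cval : continuous (\val : unit_interval R -> R).
    exact: initial_continuous.
  apply: pair_continuous.
    exact: continuousT_comp (@fst_continuous _ _) (@fst_continuous _ _).
  move=> p; apply: cvgD.
    exact: (continuousT_comp cval
      (continuousT_comp (@snd_continuous _ _) (@fst_continuous _ _))).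
  apply: cvgM; [exact: cvg_cst|apply: cvgB; first exact: cvg_cst].
  exact: (continuousT_comp cval (@snd_continuous _ _)).
- move=> z; have [x [t ->]] := reprE z.
  by rewrite GE hE clampK /G /= subr0 mulr1 addrC torus_flow_iter ?I01.
- move=> z; have [x [t ->]] := reprE z.
  rewrite GE clampK /G /= subrr mulr0 addr0 torus_flow_le1 //.
  by have /andP[] := I01 t.
Qed.

End mapping_torus_flow.

(** * Shift equivalences and mapping tori *)

Section shift_equivalence.
Variables (R : realType) (P Q : topologicalType).
Variables (kappa : P -> P) (lambda : Q -> Q) (r : P -> Q).

Definition torus_map (z : mapping_torus R kappa) : mapping_torus R lambda :=
  (fun p => torus_point lambda (r p.1) (\val p.2)) (repr z).

Hypothesis r_equivariant : forall x, r (kappa x) = lambda (r x).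

Lemma torus_map_point x t :
  torus_map (torus_point kappa x t) = torus_point lambda (r x) t.
Proof.
rewrite /torus_map (torus_lift_pi (u :=
  fun p => torus_point lambda (r p.1) (\val p.2))).
  by rewrite /torus_point clampK.
by move=> y; rewrite /= r_equivariant torus_point_glue.
Qed.

Lemma torus_map_continuous : continuous r -> continuous torus_map.
Proof.
move=> cr; apply: (quotient_continuous (Q0 := mapping_torus R kappa) _).2.
have -> : torus_map \o \pi = (fun p => torus_point lambda (r p.1) (\val p.2)).
  apply/funext => -[x t] /=.
  by have := torus_map_point x (\val t); rewrite /torus_point clampK.
apply: (@continuousT_comp _ _ _ (fun p : Q * R => torus_point lambda p.1 p.2)
  (fun p : P * unit_interval R => (r p.1, \val p.2))).
  exact: torus_point_continuous.
apply: pair_continuous.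
  exact: continuousT_comp cr (@fst_continuous _ _).
exact: continuousT_comp (@initial_continuous _ _ _) (@snd_continuous _ _).
Qed.

End shift_equivalence.

(** The maps induced by r and s compose to those induced by the k-th iterates, that is, to time-k
    maps of the semiflows. *)
Lemma shift_equivalent_mapping_torus (R : realType) (P Q : topologicalType)
    (kappa : P -> P) (lambda : Q -> Q) (r : P -> Q) (s : Q -> P) (k : nat) :
  continuous kappa -> continuous lambda -> continuous r -> continuous s ->
  (forall x, r (kappa x) = lambda (r x)) ->
  (forall y, s (lambda y) = kappa (s y)) ->
  (forall x, s (r x) = iter k kappa x) ->
  (forall y, r (s y) = iter k lambda y) ->
  homotopy_equivalent R (mapping_torus R kappa) (mapping_torus R lambda).
Proof.
move=> ck cl cr cs rk sl sr rs.
exists (@torus_map R P Q kappa lambda r), (@torus_map R Q P lambda kappa s);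
  split.
- exact: torus_map_continuous.
- exact: torus_map_continuous.
- by apply: (torus_flow_homotopic (k := k)) => // x t;
    rewrite /= !torus_map_point// sr.
- by apply: (torus_flow_homotopic (k := k)) => // y t;
    rewrite /= !torus_map_point// rs.
Qed.

(** * Long orbit segments in a compact set *)

Lemma iter_continuous (X : topologicalType) (f : X -> X) n :
  continuous f -> continuous (iter n f).
Proof.
move=> cf; elim: n => [|n IH] x; first exact: cvg_id.
exact: (continuous_comp (IH x) (cf _)).
Qed.

Lemma closed_equalizer (Y X : topologicalType) (u v : Y -> X) :
  hausdorff_space X -> continuous u -> continuous v ->
  closed [set y | u y = v y].
Proof.
move=> hX cu cv y cly; apply: hX => A B Ay By.
have nAB : nbhs y (u @^-1` A `&` v @^-1` B).
  by apply: filterI; [exact: cu|exact: cv].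
have [z [/= uvz [Az Bz]]] := cly _ nAB.
by exists (u z); split => //; rewrite uvz.
Qed.

(* A cluster point, in the product K^Z, of longer and longer orbit segments
   centered at points outside U would be a full orbit in K starting outside
   U. *)
Lemma trapped_orbit_middle (X : topologicalType) (f : X -> X) (K U : set X) :
  hausdorff_space X -> continuous f -> compact K -> open U ->
  invariant_part K f `<=` U ->
  exists m, forall x, (forall i, (i <= m + m)%N -> K (iter i f x)) ->
    U (iter m f x).
Proof.
move=> hX cf cK oU KU; apply: contrapT => /forallNP trap.
have {trap} /choice[x xP] m : exists x,
    (forall i, (i <= m + m)%N -> K (iter i f x)) /\ ~ U (iter m f x).
  by have /existsNP[x /not_implyP] := trap m; exists x.
(* Time 0 is placed at the middle of the segment. Outside [-m, m] the default m is just another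
   index up to 2m, so the values stay in K. *)
pose clip (m : nat) (k : int) : nat :=
  if (- m%:Z <= k <= m%:Z) then absz (k + m%:Z) else m.
pose gam (m : nat) : int -> X := fun k => iter (clip m k) f (x m).
have gamK m k : K (gam m k).
  by apply: (xP m).1; rewrite /clip; case: ifP => //; lia.
have gam0 m : ~ U (gam m 0).
  by have := (xP m).2; congr (~ U (iter _ f _)); rewrite /clip; case: ifP; lia.
(* At a fixed k the clipping does not interfere once m >= |k| + 1. *)
have gamS k : \forall m \near \oo, gam m (k + 1) = f (gam m k).
  near=> m; rewrite /gam -iterS; congr (iter _ f _).
  have : (absz k + 1 <= m)%N by near: m; exact: nbhs_infty_ge.
  by rewrite /clip => km; do 2 (case: ifP; last lia); lia.
have Kgam : (gam @ \oo) [set h | forall k, K (h k)].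
  by exists 0%N => // m _ k; exact: gamK.
have PF : ProperFilter (gam @ \oo) by exact: fmap_proper_filter.
have [g [gK gcl]] := tychonoff (fun _ : int => cK) PF Kgam.
(* Closed conditions pass to the cluster point g; avoiding U at time 0 and the orbit equations are
   such conditions. *)
have closedP (C : set {ptws int -> X}) : closed C ->
  (\forall m \near \oo, C (gam m)) -> C g.
  move=> cC near_C; apply: cC => V gV; have [h [/= Ch Vh]] := gcl C V near_C gV.
  by exists h.
have cpr k : continuous (fun h : {ptws int -> X} => h k).
  exact: (@proj_continuous int (fun=> X) k).
suff : U (g 0).
  apply: (closedP [set h | ~ U (h 0)]); last by apply: nearW => m; exact: gam0.
  apply: (@preimage_closed _ _ (fun h : {ptws int -> X} => h 0) (~` U)).
    by move=> h _; exact: cpr.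
  exact: open_closedC.
apply: KU; split; first exact: gK.
exists g; split=> [n||k //]; [exact: gK|by []|].
apply: (closedP [set h | h (k + 1) = f (h k)]); last exact: gamS.
apply: (@closed_equalizer {ptws int -> X} X (fun h => h (k + 1)) (fun h => f (h
  k))) => // h.
by apply: (@continuous_comp _ _ _ (fun h : {ptws int -> X} => h k));
  [exact: cpr|exact: cf].
Unshelve. all: by end_near.
Qed.

(** * The space N/L and maps out of it *)

Section index_class.
Context {X : topologicalType} (N L : set X).
Local Notation Q := (index_space N L).
Local Notation P := (N `\` L).
Local Notation base := (pquot_base (set_val @^-1` L) : Q).

(** Defined on all of X, with the base point as value outside N ([insub] is then [None]), so that
    orbits can be followed after they leave N. *)
Definition index_class (x : X) : Q := \pi_Q (insub x).

Lemma index_class_val (x : N) :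
  pquot_class (set_val @^-1` L) x = index_class (\val x).
Proof. by rewrite /index_class valK. Qed.

Lemma index_class_baseP x : index_class x = base <-> ~ P x.
Proof.
rewrite /index_class; case: insubP => [y _ <-|].
  rewrite [_ = _](pquot_class_baseP (set_val @^-1` L) y).
  by split=> [Ly [_]//|/not_andP[/(_ (set_valP y))//|/contrapT]].
by move=> /negP xN; split => // _ [Nx _]; apply: xN; exact: mem_set.
Qed.

(** Only the base point can be the class of several points, and it is not the class of x. *)
Lemma index_class_inj x y : P x -> index_class x = index_class y -> x = y.
Proof.
move=> Px xy; have Py : P y.
  by apply: contrapT => /index_class_baseP yb;
    apply/(index_class_baseP x).1: Px; rewrite xy.
have [[Nx Lx] [Ny Ly]] := (Px, Py).
pose x' : N := SigSub (mem_set Nx); pose y' : N := SigSub (mem_set Ny).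
have : pquot_class (set_val @^-1` L) x' = pquot_class (set_val @^-1` L) y'.
  by rewrite !index_class_val.
by move=> /pquot_classP[/(congr1 val)//|[]].
Qed.

Lemma index_classP q : q = base \/ exists2 x, P x & q = index_class x.
Proof.
have [->|[x ->]] := pquot_surj q; first by left.
rewrite index_class_val; have [Px|] := pselect (P (\val x)).
  by right; exists (\val x).
by move=> /index_class_baseP; left.
Qed.

Lemma index_continuousP (B : topologicalType) (u : Q -> B) :
  continuous u <-> {within N, continuous (u \o index_class)}.
Proof.
rewrite subspace_sigL_continuousP.
have -> : sigL N (u \o index_class) = u \o pquot_class (set_val @^-1` L).
  by apply/funext => x; rewrite /= index_class_val.
split => /continuousP cu; apply/continuousP => W oW.
  by have /pquot_openP := cu W oW.
by apply/pquot_openP; have := cu W oW.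
Qed.

Lemma index_base_closed : closed L -> closed [set base].
Proof.
move=> cL; rewrite -[X in closed X]setCK; apply: open_closedC.
apply/pquot_openP; exists (~` L); first exact: closed_openC.
apply/seteqP; split=> x /= Lx.
  by move=> /pquot_class_baseP.
by move=> Lx'; apply: Lx; apply/pquot_class_baseP.
Qed.

(** By regularity V can be taken with closure off L. Classes are injective there, so the image of
    this closure in N/L is closed, and it misses the base point. *)
Lemma index_base_separated z : @regular_space X -> closed L -> P z ->
  exists2 V, nbhs z V & nbhs base (~` (index_class @` (V `&` N))).
Proof.
move=> regX cL [_ Lz].
have [V Vz VL] : exists2 V, nbhs z V & closure V `<=` ~` L.
  have [|V Vz VL] := regX z (~` L);
    first exact/open_nbhs_nbhs/(conj (closed_openC cL)).
  by exists V.
exists V => //; pose O := ~` (index_class @` (closure V `&` N)).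
suff oO : open O.
  apply: (@filterS _ _ _ O).
    by move=> q Oq [v [Vv Nv] vq]; apply: Oq; exists v => //; split => //;
      exact: subset_closure.
  apply: open_nbhs_nbhs; split => // -[v [Vv Nv]] /index_class_baseP.
  by apply; split => //; exact: VL.
apply/pquot_openP; exists (~` closure V);
  first exact/closed_openC/closed_closure.
apply/seteqP; split=> x /= xV.
  move=> [v [Vv Nv]]; rewrite index_class_val => vx; apply: xV.
  suff vx' : v = \val x by move: Vv; rewrite vx'.
  by apply: index_class_inj vx; split => //; exact: VL.
move=> Vx; apply: xV; exists (\val x); last by rewrite index_class_val.
by split => //; exact: set_valP.
Qed.

Section lift.
Context {B : topologicalType} (b : B) (h : X -> B).
Hypothesis hb : forall x, ~ P x -> h x = b.

(** The factorization through N/L of a function equal to b off P; [hb] makes the representative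
    immaterial. *)
Definition index_lift (q : Q) : B := if repr q is Some x then h (\val x) else b.

Lemma index_lift_class x : index_lift (index_class x) = h x.
Proof.
rewrite /index_lift.
have : index_class x = \pi_Q (repr (index_class x)) by rewrite reprK.
case: (repr _) => [z|].
  rewrite -[X in _ = X]/(pquot_class (set_val @^-1` L) z) index_class_val.
  have [Px|Px] := pselect (P x); first by move=> /(index_class_inj Px) ->.
  move=> xz; rewrite !hb//; apply/index_class_baseP; rewrite -xz.
  exact/index_class_baseP.
by move=> /index_class_baseP/hb.
Qed.

Lemma index_lift_base : index_lift base = b.
Proof.
rewrite /index_lift.
have : base = \pi_Q (repr base) by rewrite reprK.
case: (repr _) => [z|//].
rewrite -[X in _ = X]/(pquot_class (set_val @^-1` L) z) index_class_val.
by move=> /esym/index_class_baseP/hb.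
Qed.

Lemma index_lift_continuous : {within N, continuous h} -> continuous index_lift.
Proof.
move=> ch; apply/index_continuousP.
suff -> : index_lift \o index_class = h by [].
by apply/funext => x; exact: index_lift_class.
Qed.

End lift.
End index_class.

(** * Orbit segments and iterates of the index map *)

Definition stays {X : Type} (f : X -> X) (P : set X) (n : nat) (x : X) :=
  forall i, (i <= n)%N -> P (iter i f x).

Section iterates.
Context {X : topologicalType} (f : X -> X) (N L : set X).
Local Notation g := (index_pair_map f N L).
Local Notation P := (N `\` L).
Local Notation base := (pquot_base (set_val @^-1` L) : index_space N L).
Local Notation cls := (index_class N L).

Lemma index_map_class x : P x -> g (cls x) = cls (f x).
Proof.
move=> Px; pose x' : N := SigSub (mem_set Px.1).
rewrite -[x]/(\val x') -index_class_val; have [Pfx|Pfx] := pselect (P (f x)).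
  pose y : N := SigSub (mem_set Pfx.1).
  by rewrite (@index_pair_map_in _ f N L x' y)// index_class_val.
rewrite index_pair_map_out; last by case.
exact/esym/index_class_baseP.
Qed.

Lemma iter_index_base n : iter n g base = base.
Proof. by elim: n => //= n ->; exact: index_pair_map_base. Qed.

(** The last point f^n x may lie off P: both sides are then the base point. *)
Lemma iter_index_class n x : (forall i, (i < n)%N -> P (iter i f x)) ->
  iter n g (cls x) = cls (iter n f x).
Proof.
elim: n => //= n IH Px; rewrite IH; last by move=> i /ltnW; exact: Px.
by apply: index_map_class; exact: Px.
Qed.

(** The base point is absorbing. For continuous g and closed L this makes staying in P for n steps
    an open condition on points of N. *)
Lemma iter_index_baseP n x : iter n g (cls x) <> base <-> stays f P n x.
Proof.
split=> [|xP]; last first.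
  rewrite iter_index_class; last by move=> i /ltnW; exact: xP.
  by move=> /index_class_baseP; apply; exact: xP.
elim: n x => [|n IH] x xb.
  move=> i; rewrite leqn0 => /eqP -> /=.
  by apply: contrapT => /index_class_baseP.
have Px : P x.
  apply: contrapT => /index_class_baseP xb'; apply: xb.
  by rewrite xb' iter_index_base.
move: xb; rewrite iterSr index_map_class// => /IH xP [//|i] /xP.
by rewrite -iterSr.
Qed.

End iterates.

Local Open Scope nat_scope.

Lemma stays_shift {X : Type} (f : X -> X) (P : set X) j n x :
  stays f P (n + j) x -> stays f P n (iter j f x).
Proof. by move=> xP i ni; rewrite -iterD; apply: xP; rewrite leq_add2r. Qed.

Lemma stays_le {X : Type} (f : X -> X) (P : set X) m n x :
  m <= n -> stays f P n x -> stays f P m x.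
Proof. by move=> mn xP i /leq_trans/(_ mn); exact: xP. Qed.

Lemma stays_cat {X : Type} (f : X -> X) (P : set X) j n x :
  stays f P j x -> stays f P n (iter j f x) -> stays f P (n + j) x.
Proof.
move=> jP nP i ij; have [/jP//|/ltnW ji] := leqP i j.
by rewrite -(subnK ji) iterD; apply: nP; rewrite leq_subLR addnC.
Qed.

Definition traps {X : Type} (f : X -> X) (P P' : set X) (m : nat) :=
  forall x, stays f P (m + m) x -> P' (iter m f x).

(** Of the 2n steps, the central 2m have the same middle point. *)
Lemma traps_le {X : Type} (f : X -> X) (P P' : set X) m n : m <= n ->
  traps f P P' m -> traps f P P' n.
Proof.
move=> mn trap x xP; rewrite -(subnKC mn) iterD; apply: trap.
by apply: stays_shift; apply: stays_le xP; lia.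
Qed.

(** The point f^(m+i) x is the middle of the segment of 2m steps from f^i x. *)
Lemma traps_stays {X : Type} (f : X -> X) (P P' : set X) m n x :
  traps f P P' m -> stays f P (n + (m + m)) x -> stays f P' n (iter m f x).
Proof.
move=> trap xP i ni; rewrite -iterD addnC iterD; apply: trap.
by apply: stays_shift; apply: stays_le xP; lia.
Qed.

(** * Transfer between the two index spaces *)

Section transfer.
Context {X : topologicalType} (f : X -> X) (Na La Nb Lb : set X) (m : nat).
Local Notation Pa := (Na `\` La).
Local Notation Pb := (Nb `\` Lb).
Local Notation ga := (index_pair_map f Na La).
Local Notation gb := (index_pair_map f Nb Lb).
Local Notation clsa := (index_class Na La).
Local Notation clsb := (index_class Nb Lb).
Local Notation basea := (pquot_base (set_val @^-1` La) : index_space Na La).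
Local Notation baseb := (pquot_base (set_val @^-1` Lb) : index_space Nb Lb).

(* The iterate of g_b is the base point unless f^m x, ..., f^(3m) x stay in P_b;
   otherwise it is the class of f^(3m) x. *)
Definition transfer_fun (x : X) : index_space Nb Lb :=
  if `[< stays f Pa (m + m) x >] then iter (m + m) gb (clsb (iter m f x))
  else baseb.

Lemma transfer_fun_in x : stays f Pa (m + m) x ->
  transfer_fun x = iter (m + m) gb (clsb (iter m f x)).
Proof. by move=> xP; rewrite /transfer_fun asboolT. Qed.

Lemma transfer_fun_stuck x : ~ stays f Pa (m + m) x -> transfer_fun x = baseb.
Proof. by move=> xP; rewrite /transfer_fun asboolF. Qed.

Lemma transfer_fun_out x : ~ Pa x -> transfer_fun x = baseb.
Proof. by move=> Px; apply: transfer_fun_stuck => /(_ 0 isT). Qed.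

Definition transfer : index_space Na La -> index_space Nb Lb :=
  index_lift baseb transfer_fun.

Lemma transfer_class x : transfer (clsa x) = transfer_fun x.
Proof. exact: (index_lift_class transfer_fun_out). Qed.

Lemma transfer_base : transfer basea = baseb.
Proof. exact: (index_lift_base transfer_fun_out). Qed.

Lemma transfer_class_in x : stays f Pa (m + m) x ->
  transfer (clsa x) = iter (m + m) gb (clsb (iter m f x)).
Proof. by move=> xP; rewrite transfer_class transfer_fun_in. Qed.

Lemma transfer_class_out x :
  ~ stays f Pa (m + m) x -> transfer (clsa x) = baseb.
Proof. by move=> xP; rewrite transfer_class transfer_fun_stuck. Qed.

Hypothesis trapab : traps f Pa Pb m.
Hypothesis trapba : traps f Pb Pa m.

Lemma transfer_equivariant q : transfer (ga q) = gb (transfer q).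
Proof.
have [->|[x Px ->]] := index_classP q.
  by rewrite index_pair_map_base !transfer_base index_pair_map_base.
rewrite index_map_class//.
(* As f^m x is in P_b by [trapab], the additional g_b moves it to f^(m+1) x. *)
have step : stays f Pa (m + m) x ->
    gb (transfer (clsa x)) = iter (m + m) gb (clsb (iter m f (f x))).
  move=> xP; rewrite transfer_class_in// -iterS iterSr index_map_class.
    by rewrite -iterS iterSr.
  exact: trapab.
have [xP|xP] := pselect (stays f Pa (m + m) x);
  have [fxP|fxP] := pselect (stays f Pa (m + m) (f x)).
- by rewrite step// transfer_class_in.
- rewrite step// transfer_class_out//.
  (* Otherwise f^(m+1) x, ..., f^(3m+1) x are in P_b, hence their middle f^(2m+1) x is in P_a by
     [trapba], and f x stays. *)
  apply: contrapT => fxb; apply: fxP => i.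
  have /iter_index_baseP/trapba fxa :
      iter (m + m) gb (clsb (iter m f (f x))) <> baseb by move=> e; apply: fxb.
  rewrite leq_eqVlt => /predU1P[->|im]; first by rewrite iterD.
  by rewrite -iterSr; exact: xP.
- case: xP => i; case: i => [//|i im]; rewrite iterSr.
  by apply: fxP; exact: ltnW.
- by rewrite !transfer_class_out// index_pair_map_base.
Qed.

Lemma transfer_continuous :
  @regular_space X -> continuous f -> closed Nb -> closed La -> closed Lb ->
  continuous ga -> continuous gb -> continuous transfer.
Proof.
move=> regX cf cNb cLa cLb cga cgb.
apply: (index_lift_continuous transfer_fun_out).
have /index_continuousP/subspace_continuousP cphi :=
  iter_continuous (n := m + m) cga.
have /index_continuousP/subspace_continuousP cpsi :=
  iter_continuous (n := m + m) cgb.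
have cfn n : continuous (iter n f) by exact: iter_continuous.
apply/subspace_continuousP => x Nax W; rewrite /from_subspace => Wx.
suff sW : \forall y \near x, Na y -> W (transfer_fun y) by exact: sW.
(* If x stays, so do its neighbors in N_a, the base point being closed; there the formula with g_b
   is continuous. *)
have [xP|xP] := pselect (stays f Pa (m + m) x).
  rewrite transfer_fun_in// in Wx.
  have xb : iter (m + m) ga (clsa x) <> basea by apply/iter_index_baseP.
  have Nbx : Nb (iter m f x) by have [] := trapab xP.
  have Ophi : nbhs (iter (m + m) ga (clsa x)) (~` [set basea]).
    apply: open_nbhs_nbhs; split => //.
    by apply: closed_openC; exact: index_base_closed.
  have near_stays := cphi x Nax _ Ophi.
  have near_psi := cfn m x _ (cpsi _ Nbx _ Wx).
  near=> y => Nay.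
  have yP : stays f Pa (m + m) y.
    by apply/iter_index_baseP; move: Nay; near: y; exact: near_stays.
  rewrite transfer_fun_in//.
  have Nby : Nb (iter m f y) by have [] := trapab yP.
  by move: Nby; near: y; exact: near_psi.
rewrite transfer_fun_stuck// in Wx; have Wb := nbhs_singleton Wx.
(* Neighbors that do not stay are sent to the base point, which is in W. *)
suff sW : \forall y \near x, Na y -> stays f Pa (m + m) y ->
    W (iter (m + m) gb (clsb (iter m f y))).
  apply: filterS sW => y + Nay => /(_ Nay) /= yW.
  have [yP|yP] := pselect (stays f Pa (m + m) y).
    by rewrite transfer_fun_in//; exact: yW.
  by rewrite transfer_fun_stuck.
(* If f^m x is off the closed set N_b, so is f^m y for y near x, and by [trapab] no such y stays. *)
have [Nbx|Nbx] := pselect (Nb (iter m f x)); last first.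
  have near_out : \forall y \near x, ~ Nb (iter m f y).
    apply: (cfn m x (~` Nb)); apply: open_nbhs_nbhs; split => //;
      exact: closed_openC.
  apply: filterS near_out => y yNb Nay /trapab[//].
(* If the iterate of g_b is the base point, its continuity suffices; otherwise f^m x stays in P_b,
   and [trapba] puts f^(2m) x in P_a. *)
have [xb|/iter_index_baseP/trapba] :=
    pselect (iter (m + m) gb (clsb (iter m f x)) = baseb).
  rewrite -xb in Wx; have near_psi : \forall y \near x,
      Nb (iter m f y) -> W (iter (m + m) gb (clsb (iter m f y))).
    exact: (cfn m x _ (cpsi _ Nbx W Wx)).
  apply: filterS near_psi => y yW Nay yP; apply: yW.
  by have [] := trapab yP.
(* Near x, the point f^(2m) y is near f^(2m) x, which is in P_a, and the iterate
   g_a^(2m) of the class of y is near the base point: the latter cannot be the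
   class of the former. *)
rewrite -iterD => Pax.
have [V Vx Vb] := index_base_separated regX cLa Pax.
have xb : iter (m + m) ga (clsa x) = basea.
  by apply: contrapT => /iter_index_baseP.
rewrite -xb in Vb.
have near_out : \forall y \near x, Na y ->
    ~ (index_class Na La @` (V `&` Na)) (iter (m + m) ga (clsa y)).
  exact: (cphi x Nax _ Vb).
have near_V := cfn (m + m) x _ Vx.
near=> y => Nay yP; exfalso.
have Vy : V (iter (m + m) f y) by near: y; exact: near_V.
suff : ~ (index_class Na La @` (V `&` Na)) (iter (m + m) ga (clsa y)).
  apply; exists (iter (m + m) f y).
    by split => //; have [] := yP (m + m) (leqnn _).
  by rewrite iter_index_class// => i /ltnW; exact: yP.
by move: Nay; near: y; exact: near_out.
Unshelve. all: by end_near.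
Qed.

End transfer.

(** Both sides are the class of f^(6m) x or the base point. The left one asks for P_a at times 0 to
    2m and 4m to 6m and for P_b at times m to 5m; by the traps this amounts to P_a at all times 0 to
    6m. *)
Lemma transferK {X : topologicalType} (f : X -> X) (Na La Nb Lb : set X)
    (m : nat) :
  traps f (Na `\` La) (Nb `\` Lb) m -> traps f (Nb `\` Lb) (Na `\` La) m ->
  forall q, @transfer X f Nb Lb Na La m (@transfer X f Na La Nb Lb m q) =
    iter ((m + m) + (m + m) + (m + m)) (index_pair_map f Na La) q.
Proof.
move=> trapab trapba q.
have [->|[x Px ->]] := index_classP q.
  by rewrite !transfer_base iter_index_base.
set Pa := Na `\` La; set Pb := Nb `\` Lb.
set M := (m + m).
have [xP|xP] := pselect (stays f Pa (M + M + M) x).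
  have xPb : stays f Pb (M + M) (iter m f x) by exact: traps_stays trapab xP.
  rewrite transfer_class_in; last by apply: stays_le xP; rewrite /M; lia.
  rewrite iter_index_class; last first.
    by move=> i iM; apply: xPb; rewrite /M in iM *; lia.
  rewrite -iterD transfer_class_in; last first.
    by rewrite iterD; apply: stays_shift.
  rewrite -iterD iter_index_class.
    rewrite iter_index_class -?iterD; last by move=> i /ltnW; exact: xP.
    by congr (index_class _ _ (iter _ f x)); rewrite /M; lia.
  by move=> i iM; rewrite -iterD; apply: xP; rewrite /M in iM *; lia.
have -> : iter (M + M + M) (index_pair_map f Na La) (index_class Na La x) =
    pquot_base _.
  by apply: contrapT => /iter_index_baseP.
have [xPa|xPa] := pselect (stays f Pa M x);
  last by rewrite transfer_class_out// transfer_base.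
rewrite transfer_class_in//.
have [xPb|xPb] := pselect (stays f Pb M (iter m f x)); last first.
  have -> : iter (m + m) (index_pair_map f Nb Lb)
      (index_class Nb Lb (iter m f x)) = pquot_base _.
    by apply: contrapT => /iter_index_baseP.
  by rewrite transfer_base.
rewrite iter_index_class; last by move=> i /ltnW; exact: xPb.
rewrite -iterD.
have [yPb|yPb] := pselect (stays f Pb M (iter (m + m + m) f x)); last first.
  by rewrite transfer_class_out.
rewrite transfer_class_in// -iterD.
apply: contrapT => /iter_index_baseP zPa; apply: xP.
(* P_b at times m to 5m gives P_a at times 2m to 4m, which fills the gap between the two known
   segments. *)
have mxPb : stays f Pb (M + M) (iter m f x).
  by apply: stays_cat => //; rewrite -iterD.
have MxPa : stays f Pa M (iter M f x).
  by rewrite /M iterD; exact: traps_stays trapba mxPb.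
rewrite -addnA; apply: (stays_cat (j := M + M)); first exact: stays_cat.
by congr (stays f Pa M (iter _ f x)): zPa; rewrite /M; lia.
Qed.

(** * Application to two index pairs *)

Lemma index_pair_traps (R : realType) (X : metricType R) (f : X -> X)
    (S Na La Nb Lb : set X) :
  continuous f -> index_pair f S Na La -> index_pair f S Nb Lb ->
  exists m, traps f (Na `\` La) (Nb `\` Lb) m.
Proof.
move=> cf [_ [cNa cLa] inva _ _] [_ _ _ Sb _].
have hX : hausdorff_space X by exact: metric_hausdorff.
have cK : compact (closure (Na `\` La)).
  apply: (subclosed_compact _ cNa); first exact: closed_closure.
  rewrite [X in _ `<=` X](iffLR (closure_id Na)); last exact: compact_closed.
  by apply: closureS => x [].
(* Here the two pairs share S: it is the invariant part of cl P_a and lies in the interior of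
   P_b. *)
have KU : invariant_part (closure (Na `\` La)) f `<=` (Nb `\` Lb)°.
  by rewrite inva.
have [m mP] := trapped_orbit_middle hX cf cK (@open_interior _ _) KU.
exists m => x xP; apply: interior_subset; apply: mP => i im.
by apply: subset_closure; exact: xP.
Qed.

Theorem theorem3p5 (R : realType) (X : metricType R) (f : X -> X) (S : set X)
    (Na La Nb Lb : set X) :
  locally_compact [set: X] ->
  continuous f ->
  isolated_invariant f S ->
  index_pair f S Na La ->
  index_pair f S Nb Lb ->
  homotopy_equivalent R (mapping_torus R (index_pair_map f Na La))
                        (mapping_torus R (index_pair_map f Nb Lb)).
Proof.
move=> _ cf _ pa pb.
have hX : hausdorff_space X by exact: metric_hausdorff.
have regX : @regular_space X by exact: uniform_regular.
have [m1 trapab] := index_pair_traps cf pa pb.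
have [m2 trapba] := index_pair_traps cf pb pa.
(* One m serves both directions, since traps persist for larger m. *)
pose m := maxn m1 m2.
have {}trapab := traps_le (leq_maxl m1 m2) trapab.
have {}trapba := traps_le (leq_maxr m1 m2) trapba.
have [_ [cNa cLa] _ _ cga] := pa; have [_ [cNb cLb] _ _ cgb] := pb.
(* The lag k is left open here; [transferK] fixes it as 6m. *)
apply: (@shift_equivalent_mapping_torus _ _ _ _ _
  (@transfer X f Na La Nb Lb m) (@transfer X f Nb Lb Na La m)) => //.
- by apply: transfer_continuous => //; exact: compact_closed.
- by apply: transfer_continuous => //; exact: compact_closed.
- exact: transfer_equivariant.
- exact: transfer_equivariant.
- exact: transferK.
- exact: transferK.
Qed.
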